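(* Let $G$ be a finite solvable group with $G\in\mathcal{D}_n$. Then the derived length of $G$ is at most $3\log_2(n+1)+9$.
   Context: $\mathcal{D}(G)$ denotes the number of conjugacy classes of nontrivial subgroups $H$ of the finite group $G$ with $N_G(H)\neq H$; $\mathcal{D}_n$ is the family of finite groups $G$ with $\mathcal{D}(G)=n$. *)

(* Defs.v *)
From Stdlib Require Reals.
From mathcomp Require Import all_boot all_fingroup all_solvable.

Set Implicit Arguments.
Unset Strict Implicit.
Unset Printing Implicit Defensive.

Local Open Scope group_scope.

Definition nonSN_subgroups (gT : finGroupType) (G : {group gT}) : {set {group gT}} :=
  [set H : {group gT} | [&& H \subset G, H != 1 :> {set gT} & 'N_G(H) != H]].

Definition D_count (gT : finGroupType) (G : {group gT}) : nat :=
  #|[set (H :^: G) | H : {group gT} in nonSN_subgroups G]|.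

(* Derived length: least k with G^(k) = 1.  The derived series of a solvable
   group reaches 1 within #|G| steps, so searching in [0, #|G|] suffices. *)
Definition derived_length (gT : finGroupType) (G : {group gT}) : nat :=
  find (fun k => G^`(k) == 1) (iota 0 #|G|.+1).

Definition dl_bound (n : nat) : Reals.Rdefinitions.R :=
  Reals.Rdefinitions.Rplus
    (Reals.Rdefinitions.Rmult (Reals.Raxioms.INR 3)
       (Reals.Rdefinitions.Rdiv (Reals.Rpower.ln (Reals.Raxioms.INR (n + 1)))
                                 (Reals.Rpower.ln (Reals.Raxioms.INR 2))))
    (Reals.Raxioms.INR 9).

(* Main.v *)
Require Import Defs.
From Stdlib Require Reals Lra.
From mathcomp Require Import all_boot all_fingroup all_solvable.
From mathcomp Require Import zify.

(**
  Let S(G) be the number of conjugacy classes of subgroups H of G with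
  N_G(H) <> H, the trivial subgroup included, so that S(G) = n + 1 for G <> 1.
  By induction on |G|, a solvable G <> 1 satisfies 2^d <= 4 S(G)^3 for some d
  with G^(d) = 1.

  If two nontrivial normal subgroups A, B meet trivially, then G embeds in
  G/A x G/B and S(G/A), S(G/B) <= S(G).  If G' is nilpotent of class c, the
  lower central series of G' shows S(G) > c, while G' has derived length at most
  log_2 c + 1.

  Otherwise let N <= G' be a minimal non-nilpotent normal subgroup of G.  Since
  F = F(N) is then an r-group, N = F C with C an abelian Hall r'-subgroup of N
  and [F, C] = F.  For every H >= N with N_G(H) <> H and every term L of the
  lower central series of F, the subgroup K = N_H(C) L is again not
  self-normalizing: the Frattini argument applied to N_G(H) yields elements of
  N_G(H) outside H normalizing K.  The class of K determines that of H = K N,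
  and |K| determines |N_F(C) L|.  By the three subgroups lemma two consecutive
  terms of the descending chain N_F(C) L cannot both fail to drop, so if F has
  class c then S(G) >= (1 + ceil(c/2)) S(G/N), and (1 + ceil(c/2))^3 >= 4c pays
  for the derived length of N, which is at most log_2 c + 2.
*)

Set Implicit Arguments.
Unset Strict Implicit.
Unset Printing Implicit Defensive.

Local Open Scope group_scope.

(** * Lower central series *)

Section CentralSeries.

Variable gT : finGroupType.
Implicit Types A B C F G H K N X : {group gT}.

(** The three subgroups lemma relative to [X]: all three groups normalize [X], so it applies to
    their images modulo [X]. *)
Lemma three_subgroup_sub A B C X :
    A \subset 'N(X) -> B \subset 'N(X) -> C \subset 'N(X) ->
    [~: A, B, C] \subset X -> [~: B, C, A] \subset X ->
  [~: C, A, B] \subset X.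
Proof.
move=> nXA nXB nXC.
have sub_quo (U V W : {group gT}) :
    U \subset 'N(X) -> V \subset 'N(X) -> W \subset 'N(X) ->
    ([~: U, V, W] \subset X) = ([~: U / X, V / X, W / X] == 1).
  move=> nXU nXV nXW; have nXUV : [~: U, V] \subset 'N(X) by apply: comm_subG.
  by rewrite -quotient_sub1 ?comm_subG // !quotientR // subG1.
rewrite !sub_quo // => /eqP ABC1 /eqP BCA1.
exact/eqP/three_subgroup.
Qed.

(** Since ['L_1(G)] is [G], indices are weights and add under commutators. The induction on [j]
    writes the second term as a commutator with [G] and uses the three subgroups lemma. *)
Lemma lcn_comm G i j : [~: 'L_i.+1(G), 'L_j.+1(G)] \subset 'L_(i + j).+2(G).
Proof.
elim: j i => [|j IHj] i; first by rewrite addn0.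
have nL m n : 'L_m(G) \subset 'N('L_n(G)).
  exact: subset_trans (lcn_sub m G) (lcn_norm n G).
rewrite lcnSn commGC.
apply: (@three_subgroup_sub G 'L_i.+1(G)%G 'L_j.+1(G)%G
                              'L_(i + j.+1).+2(G)%G); rewrite ?nL ?lcn_norm //.
  by rewrite [[~: G, _]]commGC -lcnSn addnS -addSn; apply: IHj.
by rewrite addnS; apply: commSg (IHj i).
Qed.

Lemma der_sub_lcn G k : G^`(k) \subset 'L_(2 ^ k)(G).
Proof.
elim: k => [|k IHk]; first by rewrite expn0.
rewrite dergSn; apply: subset_trans (commgSS IHk IHk) _.
rewrite expnS mul2n -addnn; have: 0 < (2 ^ k)%N by rewrite expn_gt0.
by case: (2 ^ k)%N => // m _; rewrite addnS; apply: lcn_comm.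
Qed.

Lemma nilpotent_der_eq1 G :
  nilpotent G -> exists2 k, G^`(k) = 1 & (2 ^ k)%N <= maxn 1 (nil_class G).*2.
Proof.
move=> nilG; case: (posnP (nil_class G)) => [c0 | c_gt0].
  exists 0; first by apply/eqP; rewrite -nil_class0 c0.
  by rewrite c0.
(* The least k with 2^k above the class, so that 2^k is at most twice the class. *)
exists (trunc_log 2 (nil_class G)).+1.
  apply/trivgP/(subset_trans (der_sub_lcn _ _)).
  have /andP[_] := trunc_log_bounds (isT : 1 < 2) c_gt0.
  have: 0 < (2 ^ (trunc_log 2 (nil_class G)).+1)%N by rewrite expn_gt0.
  case: (2 ^ _)%N => // m _; rewrite ltnS => /(lcn_nil_classP m nilG) ->.
  exact: sub1G.
have /andP[le _] := trunc_log_bounds (isT : 1 < 2) c_gt0.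
by rewrite leq_max expnS mul2n leq_double le orbT.
Qed.

(** * Action of [C] on the lower central series of [F] *)

Section Supplement.

Variables F C : {group gT}.
Hypotheses (nilF : nilpotent F) (nFC : C \subset 'N(F)) (tiFC : F :&: C = 1).
Hypothesis defF : [~: F, C] = F.

Let nLC n : C \subset 'N('L_n(F)).
Proof. exact: char_norm_trans (lcn_char _ _) nFC. Qed.

Let nLF n : F \subset 'N('L_n(F)). Proof. exact: lcn_norm. Qed.

(** ['N_F(C)] centralizes [C], because their commutator lies in both [F] and [C]. Only the factor
    ['L_j.+1(F)], normalized by [C], contributes. *)
Lemma lcn_supplement_comm j :
    'L_j(F) \subset 'N_F(C) * 'L_j.+1(F) ->
  [~: 'L_j(F), C] \subset 'L_j.+1(F).
Proof.
move=> sLNL; apply: subset_trans (commSg C sLNL) _.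
have cNC : [~: 'N_F(C), C] = 1.
  apply/trivgP; rewrite -tiFC subsetI; apply/andP; split.
    by apply: subset_trans (commSg C (subsetIl _ _)) _; rewrite commg_subl.
  by rewrite commg_subr subsetIr.
rewrite commMG; first by rewrite cNC mul1g commg_subl nLC.
by rewrite cNC norm1 subsetT.
Qed.

(** As [F, C] = F, ['L_j.+2(F)] is [F, C, ['L_j.+1(F)]]. The two hypotheses put the other two cyclic
    commutators into ['L_j.+3(F)], so the series becomes stationary, which nilpotency allows only at
    1. *)
Lemma lcn_supplement_two_steps j :
    'L_j.+1(F) \subset 'N_F(C) * 'L_j.+2(F) ->
    'L_j.+2(F) \subset 'N_F(C) * 'L_j.+3(F) ->
  'L_j.+2(F) = 1.
Proof.
move=> /lcn_supplement_comm s1 /lcn_supplement_comm s2.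
suffices : 'L_j.+2(F) \subset 'L_j.+3(F).
  have ->: 'L_j.+3(F) = [~: 'L_j.+2(F), F] by [].
  move=> sLL; apply/eqP; apply: contraTT nilF => ntL.
  apply/forallPn; exists 'L_j.+2(F)%G.
  by rewrite negb_imply subsetI sLL lcn_sub.
have {1}->: 'L_j.+2(F) = [~: F, C, 'L_j.+1(F)] by rewrite defF commGC.
have nLL m n : 'L_m(F) \subset 'N('L_n(F)).
  exact: subset_trans (lcn_sub m F) (nLF n).
apply: (@three_subgroup_sub C 'L_j.+1(F)%G F 'L_j.+3(F)%G);
  rewrite ?nLL ?nLC ?nLF //.
  by rewrite [[~: C, _]]commGC; apply: commSg s1.
Qed.

(* The index a.*2.-1 runs through 0, 1, 3, 5, ...: the first step of the chain
   always drops, because [F, C] = F, and later ones drop at least every second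
   time. *)
Lemma supplement_lcn_inj a b :
    a <= uphalf (nil_class F) -> b <= uphalf (nil_class F) ->
    #|'N_F(C) * 'L_a.*2.-1.+1(F)| = #|'N_F(C) * 'L_b.*2.-1.+1(F)| ->
  a = b.
Proof.
wlog: a b / a <= b => [IH le_a le_b eq_ab|].
  by case/orP: (leq_total a b) => le_ab; [|symmetry]; apply: IH => //.
rewrite leq_eqVlt => /orP[/eqP // | lt_ab] _ le_b eq_card.
have sML m n : n <= m ->
    'N_F(C) * 'L_m.+1(F) \subset 'N_F(C) * 'L_n.+1(F).
  by move=> le_nm; rewrite mulgS // lcn_sub_leq.
have eq_ab : 'N_F(C) * 'L_a.*2.-1.+1(F) = 'N_F(C) * 'L_b.*2.-1.+1(F).
  apply/esym/eqP; rewrite eqEcard eq_card leqnn andbT sML //.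
  by rewrite -!subn1 leq_sub2r ?leq_double ?(ltnW lt_ab).
(* Equality at the two ends stops every intermediate drop. *)
have sL m : a.*2.-1 <= m -> m.+1 < b.*2 ->
    'L_m.+1(F) \subset 'N_F(C) * 'L_m.+2(F).
  move=> le_am lt_mb; apply: subset_trans (mulG_subr 'N_F(C)%G _) _.
  apply: subset_trans (sML _ _ le_am) _; rewrite eq_ab sML //.
  by rewrite -ltnS prednK // (leq_trans _ lt_mb).
have lt_2a : a.*2.+1 < b.*2.
  by rewrite -doubleS leq_double in lt_ab *.
(* For a = 0 the first step already fails to drop, which would give F = F'. Otherwise two
   consecutive failures make the class smaller than the bound on [b] requires. *)
case: a => [|a] in lt_ab sL lt_2a {eq_card eq_ab} *.
  have /lcn_supplement_comm := sL 0 isT lt_2a.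
  rewrite defF => sFF'; have solF := nilpotent_sol nilF.
  have /(sol_der1_proper solF (subxx F)): F :!=: 1.
    rewrite -nil_class0 -lt0n -uphalf_gt0.
    exact: leq_trans (leq_ltn_trans (leq0n _) lt_ab) le_b.
  by rewrite properE sFF' andbF.
have L1 : 'L_a.*2.+3(F) = 1.
  apply: lcn_supplement_two_steps; apply: sL; rewrite ?doubleS //=.
  exact: ltnW.
have /(lcn_nil_classP _ nilF) := L1.
rewrite leqNgt => /negP[]; rewrite -ltnS -doubleS.
by apply: leq_trans lt_2a _; rewrite -geq_half_double -uphalfE.
Qed.

End Supplement.
End CentralSeries.

(** * Classes of non-self-normalizing subgroups *)

(** Subgroups above [N] stand for those of [G / N] inside the same type. With [N] = 1 the classes
    number S(G). *)
Definition nonSN_over (gT : finGroupType) (G N : {group gT}) :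
    {set {group gT}} :=
  [set H : {group gT} | [&& N \subset H, H \subset G & 'N_G(H) != H]].

Definition nonSN_classes (gT : finGroupType) (G N : {group gT}) :
    {set {set {set gT}}} :=
  [set H :^: G | H : {group gT} in nonSN_over G N].

Section NonSNClasses.

Variable gT : finGroupType.
Implicit Types A B C F G H K N : {group gT}.

Lemma nonSN_classesS G N : nonSN_classes G N \subset nonSN_classes G 1.
Proof.
apply: imsetS; apply/subsetP=> H; rewrite !inE => /and3P[_ -> ->].
by rewrite sub1G.
Qed.

Lemma proper_normal_nonSN G H : H <| G -> H \proper G -> H \in nonSN_over G 1.
Proof.
rewrite inE sub1G properE => /andP[sHG nHG] /andP[_ nsGH]; rewrite sHG /=.
by rewrite (setIidPl nHG); apply: contraNneq nsGH => ->.
Qed.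

Lemma card_nonSN_classes G : #|nonSN_classes G 1| <= (D_count G).+1.
Proof.
set D := [set H :^: G | H : {group gT} in nonSN_subgroups G].
have: nonSN_classes G 1 \subset (1%G : {set gT}) :^: G |: D.
  apply/subsetP=> _ /imsetP[H + ->]; rewrite !inE => /and3P[_ sHG nsnH].
  case: (eqVneq (H : {set gT}) 1) => [-> | ntH]; first by rewrite eqxx.
  by apply/orP; right; apply: imset_f; rewrite inE sHG ntH.
move/subset_leq_card/leq_trans; apply.
by rewrite cardsU1 -add1n leq_add2r leq_b1.
Qed.

Lemma quotient_nonSN_classes G N :
  N <| G -> #|nonSN_classes (G / N) 1| <= #|nonSN_classes G N|.
Proof.
case/andP=> sNG nNG.
(* [quo] sends classes above [N] onto a family containing all those of [G / N], as normalizers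
   correspond. *)
pose quo (X : {set {set gT}}) := [set A / N | A : {set gT} in X].
apply: leq_trans (leq_imset_card quo _).
apply: subset_leq_card; apply/subsetP=> _ /imsetP[Hq + ->].
rewrite inE sub1G /= => /andP[sHqG nsnHq].
have [H defHq sNH sHG] := inv_quotientS (introT andP (conj sNG nNG)) sHqG.
have nNH := subset_trans sHG nNG.
apply/imsetP; exists (H :^: G).
  apply: imset_f; rewrite inE sNH sHG /=.
  apply: contraNneq nsnHq => eqH.
  by rewrite defHq -quotient_subnormG ?eqH // /normal sNH.
apply/setP=> X; apply/imsetP/imsetP.
  case=> xq /morphimP[x Nx Gx ->] ->; exists (H :^ x).
    by apply: imset_f.
  by rewrite quotientJ // defHq.
case=> _ /imsetP[x Gx ->] ->; exists (coset N x).
  by rewrite mem_quotient.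
by rewrite quotientJ ?defHq // (subsetP nNG).
Qed.

(** The c + 1 terms from G' down to 1 are distinct, normal and proper in [G]; each is a class by
    itself. *)
Lemma nil_class_der1_classes G :
    solvable G -> G :!=: 1 -> nilpotent G^`(1) ->
  nil_class G^`(1) < #|nonSN_classes G 1|.
Proof.
move=> solG ntG nilG'; set c := nil_class _.
pose f (i : 'I_c.+1) : {set {set gT}} := 'L_i.+1(G^`(1)) :^: G.
have nL n : 'L_n(G^`(1)) <| G.
  exact: char_normal_trans (lcn_char _ _) (der_normal _ _).
have inj_f : injective f.
  have fE i : f i = [set 'L_i.+1(G^`(1))].
    apply/setP=> X; rewrite inE; apply/imsetP/eqP => [[x Gx ->] | ->].
      exact: (normsP (normal_norm (nL _))).
    by exists 1; rewrite ?conjsg1.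
  move=> i j; rewrite !fE => /set1_inj.
  wlog: i j / i <= j => [IH eqL|].
    by case/orP: (leq_total i j) => le; [|symmetry]; apply: IH => //.
  rewrite leq_eqVlt => /orP[/eqP/val_inj // | lt_ij] eqL.
  have sL : 'L_i.+1(G^`(1)) \subset 'L_i.+2(G^`(1)).
    by rewrite eqL lcn_sub_leq.
  have L1 : 'L_i.+1(G^`(1)) = 1.
    apply/eqP; apply: contraTT nilG' => ntL.
    apply/forallPn; exists 'L_i.+1(G^`(1))%G.
    by rewrite negb_imply subsetI sL lcn_sub.
  have /(lcn_nil_classP _ nilG') := L1.
  by rewrite leqNgt (leq_trans lt_ij) // -ltnS.
rewrite -[X in X <= _]card_ord -cardsT -(card_imset _ inj_f).
apply: subset_leq_card; apply/subsetP=> _ /imsetP[i _ ->].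
apply: imset_f; apply: (@proper_normal_nonSN _ 'L_i.+1(G^`(1))%G (nL _)).
exact: sub_proper_trans (lcn_sub _ _) (sol_der1_proper solG (subxx G) ntG).
Qed.

(** * Counting classes through the supplements [supp H i] *)

Section SupplementCount.

Variables (pi : nat_pred) (G N F C : {group gT}).
Hypotheses (nsNG : N <| G) (nsFG : F <| G) (solN : solvable N).
Hypotheses (hallC : pi.-Hall(N) C) (defN : F * C = N) (tiFC : F :&: C = 1).
Hypotheses (nilF : nilpotent F) (defF : [~: F, C] = F).

Let supp (H : {group gT}) i := ('N_H(C) <*> 'L_i.*2.-1.+1(F))%G.

Let nLG n : G \subset 'N('L_n(F)).
Proof. exact: char_norm_trans (lcn_char _ _) (normal_norm nsFG). Qed.

Let sFN : F \subset N. Proof. by rewrite -defN mulG_subl. Qed.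
Let sCN : C \subset N. Proof. by rewrite -defN mulG_subr. Qed.

Let Frattini H : N \subset H -> H \subset G -> F * 'N_H(C) = H.
Proof.
move=> sNH sHG.
have nsNH : N <| H := normalS sNH sHG nsNG.
rewrite -{2}(Hall_Frattini_arg solN nsNH hallC) -defN -mulgA.
have /mulSGid->// : C \subset 'N_H(C).
by rewrite subsetI (subset_trans sCN sNH) normG.
Qed.

Let suppE H i :
  H \subset G -> supp H i = 'N_H(C) * 'L_i.*2.-1.+1(F) :> {set gT}.
Proof.
move=> sHG; rewrite /= norm_joinEl //.
exact: subset_trans (subsetIl _ _) (subset_trans sHG (nLG _)).
Qed.

Let supp_sub H i : N \subset H -> supp H i \subset H.
Proof.
move=> sNH; rewrite join_subG subsetIl.
exact: subset_trans (lcn_sub _ _) (subset_trans sFN sNH).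
Qed.

Let supp_mul H i : N \subset H -> H \subset G -> N * supp H i = H.
Proof.
move=> sNH sHG; apply/eqP; rewrite eqEsubset mul_subG ?supp_sub //=.
by rewrite -{1}(Frattini sNH sHG) mulgSS // joing_subl.
Qed.

Let supp_capF H i :
  N \subset H -> H \subset G -> supp H i :&: F = 'N_F(C) * 'L_i.*2.-1.+1(F).
Proof.
move=> sNH sHG; rewrite suppE // setIC -group_modr ?lcn_sub //.
by rewrite setIA (setIidPl (subset_trans sFN sNH)).
Qed.

(** The product formula for H = [supp H i] F: the order of [supp H i] is controlled by its
    intersection with [F], which does not depend on [H]. *)
Let card_supp H i : N \subset H -> H \subset G ->
  (#|supp H i| * #|F| = #|H| * #|('N_F(C) * 'L_i.*2.-1.+1(F))%g|)%N.
Proof.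
move=> sNH sHG; rewrite -(supp_capF i sNH sHG) mul_cardG; congr (_ * _)%N.
apply: eq_card; apply/setP/eqP.
rewrite eqEsubset mul_subG ?supp_sub ?(subset_trans sFN) //=.
rewrite -{1}(Frattini sNH sHG).
rewrite -normC; first by rewrite mulSg ?joing_subl.
exact: subset_trans (subsetIl _ _) (subset_trans sHG (normal_norm nsFG)).
Qed.

(** Frattini writes N_G(H) as F times the normalizer of [C] in it. That normalizer acts on
    [supp H i]; if the latter were self-normalizing, it would lie in [H], and so would N_G(H). *)
Let supp_nonSN H i :
  H \in nonSN_over G N -> supp H i \in nonSN_over G 1.
Proof.
rewrite !inE sub1G => /and3P[sNH sHG nsnH].
rewrite (subset_trans (supp_sub _ sNH) sHG) /=.
apply: contraNneq nsnH => snS.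
set L := 'N_G(H)%G; have sLG : L \subset G := subsetIl _ _.
have sHL : H \subset L by rewrite subsetI sHG normG.
rewrite eqEsubset sHL andbT.
rewrite -(Frattini (subset_trans sNH sHL) sLG).
apply: mul_subG; first exact: subset_trans sFN sNH.
apply: subset_trans _ (supp_sub i sNH).
have <- : 'N_G(supp H i) = supp H i := snS.
rewrite subsetI (subset_trans (subsetIl _ _) sLG) /=.
apply: normsY; last first.
  exact: subset_trans (subsetIl _ _) (subset_trans sLG (nLG _)).
apply: normsI; last exact: subset_trans (subsetIr _ _) (normG _).
by rewrite subIset // subIset // subxx orbT.
Qed.

Lemma nonSN_classes_supplement :
  #|nonSN_classes G N| * (uphalf (nil_class F)).+1 <= #|nonSN_classes G 1|.
Proof.
pose rep X := odflt 1%G [pick H in nonSN_over G N | H :^: G == X].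
have repP X : X \in nonSN_classes G N ->
    rep X \in nonSN_over G N /\ rep X :^: G = X.
  case/imsetP=> H inH defX; rewrite /rep; case: pickP => [K /andP[? /eqP] // |].
  by move/(_ H); rewrite inH defX eqxx.
set m := (uphalf _).+1.
pose f (Xi : {set {set gT}} * 'I_m) : {set {set gT}} :=
  supp (rep Xi.1) Xi.2 :^: G.
rewrite -[m]card_ord -cardsT -cardsX -(@card_in_imset _ _ f).
  apply: subset_leq_card.
  apply/subsetP=> _ /imsetP[[X i] /setXP[/repP[repX _] _] ->].
  exact: (imset_f (fun K : {group gT} => K :^: G) (supp_nonSN i repX)).
move=> [X i] [Y j] /setXP[/= inX _] /setXP[/= inY _] eq_f.
have [+ defX] := repP _ inX; rewrite inE => /and3P[sNX sXG _].
have [+ defY] := repP _ inY; rewrite inE => /and3P[sNY sYG _].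
have: (supp (rep X) i : {set gT}) \in supp (rep Y) j :^: G.
  have <- : f (X, i) = supp (rep Y) j :^: G := eq_f.
  by apply/imsetP; exists 1; rewrite ?conjsg1.
case/imsetP=> x Gx eq_supp.
(* Multiplying by the normal subgroup [N] recovers the representative from its supplement. *)
have eqJ : rep X = rep Y :^ x :> {set gT}.
  rewrite -(supp_mul i sNX sXG) eq_supp.
  by rewrite -{1}(normsP (normal_norm nsNG) x Gx) -conjsMg supp_mul.
have eqXY : X = Y.
  rewrite -defX -defY eqJ; apply/setP=> A; apply/imsetP/imsetP.
    by case=> y Gy ->; exists (x * y); rewrite ?groupM // conjsgM.
  case=> y Gy ->; exists (x^-1 * y); rewrite ?groupM ?groupV //.
  by rewrite -conjsgM mulKVg.
congr (_, _) => //; apply/val_inj => /=.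
have nFC : C \subset 'N(F).
  exact: subset_trans sCN (subset_trans (normal_sub nsNG) (normal_norm nsFG)).
apply: (supplement_lcn_inj nilF nFC tiFC defF); first exact: (ltn_ord i).
  exact: (ltn_ord j).
have := congr1 (fun A : {set gT} => #|A| * #|F|)%N eq_supp.
rewrite cardJg !card_supp // eqXY.
by move/eqP; rewrite eqn_pmul2l ?cardG_gt0 // => /eqP.
Qed.

End SupplementCount.

End NonSNClasses.

(** * Derived series and the minimal non-nilpotent normal subgroup *)

Section DerivedSeries.

Variable gT : finGroupType.
Implicit Types A F G H N : {group gT}.

Lemma derD G m n : G^`(m + n) = (G^`(n))^`(m).
Proof. by elim: m => // m IHm; rewrite addSn !dergSn IHm. Qed.

Lemma der_sub_leq G m n : m <= n -> G^`(n) \subset G^`(m).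
Proof. by move=> le_mn; rewrite -(subnK le_mn) derD der_sub. Qed.

Lemma quotient_der_eq1 G A d :
  A <| G -> (G / A)^`(d) = 1 -> G^`(d) \subset A.
Proof.
case/andP=> _ nAG; rewrite -quotient_der // => /trivgP.
by rewrite quotient_sub1 // (subset_trans (der_sub _ _)).
Qed.

(** [find] never exceeds the length [#|G|.+1] of its list, so a [d] below its value lies in the
    searched range. *)
Lemma derived_length_leq G d : G^`(d) = 1 -> derived_length G <= d.
Proof.
move=> Gd1; rewrite /derived_length.
set a := fun k => _; set s := iota _ _.
rewrite leqNgt; apply/negP=> lt_d.
have := before_find 0 lt_d; rewrite nth_iota ?add0n ?/a ?Gd1 ?eqxx //.
by have := leq_trans lt_d (find_size a s); rewrite size_iota.
Qed.

Lemma minimal_nonnilpotent_structure G H :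
    solvable G -> H <| G -> ~~ nilpotent H ->
    (forall A B : {group gT}, A <| G -> B <| G -> A :&: B = 1 ->
       A :!=: 1 -> B :=: 1) ->
  exists pi : nat_pred, exists N F C : {group gT},
    [/\ N <| G, N \subset H, F <| G, nilpotent F & N^`(1) \subset F]
    /\ [/\ pi.-Hall(N) C, F * C = N, F :&: C = 1, [~: F, C] = F & F :!=: 1].
Proof.
move=> solG nsHG nnilH mono.
pose gP := [pred N : {group gT} | (N <| G) && ~~ nilpotent N].
have gPH : gP H by rewrite /= nsHG.
have [N /mingroupP[/andP[/= nsNG nnilN] minN] sNH] := mingroup_exists gPH.
have solN := solvableS (normal_sub nsNG) solG.
have nilP (Y : {group gT}) : Y <| G -> Y \subset N -> Y :!=: N -> nilpotent Y.
  move=> nsYG sYN; apply: contraNT => nnilY.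
  by apply/eqP; apply: minN; rewrite /gP /= ?nsYG.
have ntN : N :!=: 1 by apply: contraNneq nnilN => ->; apply: nilpotent1.
have nilN' : nilpotent N^`(1).
  apply: nilP; rewrite ?der_sub ?(char_normal_trans (der_char _ _)) //.
  by have := sol_der1_proper solN (subxx N) ntN; rewrite properEneq => /andP[].
pose F := 'F(N)%G.
have nsFN : F <| N := Fitting_normal N.
have sN'F : N^`(1) \subset F by apply: Fitting_max; rewrite ?der_normal.
have nsFG : F <| G by apply: char_normal_trans (Fitting_char N) nsNG.
have ntF : F :!=: 1 by rewrite trivg_Fitting.
have nilF : nilpotent F := Fitting_nil N.
pose r := pdiv #|F|.
have rF : r.-group F.
  (* ['O_r(F)] is nontrivial and meets ['O_r^'(F)] trivially, so [mono] applies. *)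
  have O1 : 'O_r^'(F) = 1.
    apply: (@mono 'O_r(F)%G 'O_r^'(F)%G).
    - exact: char_normal_trans (pcore_char _ _) nsFG.
    - exact: char_normal_trans (pcore_char _ _) nsFG.
    - by have /dprodP[_ _ _ ->] := nilpotent_pcoreC r nilF.
    rewrite -cardG_gt1 (card_Hall (nilpotent_pcore_Hall r nilF)) p_part_gt1.
    by rewrite pi_pdiv cardG_gt1.
  have /dprodP[_ + _ _] := nilpotent_pcoreC r nilF.
  by rewrite O1 mulg1 => <-; apply: pcore_pgroup.
have [X sylX] := Sylow_exists r N.
have sFX : F \subset X.
  by rewrite (normal_sub_max_pgroup (Hall_max sylX)).
(* [X] contains N', hence is normal in [N]; being nilpotent, it lies in the Fitting subgroup. *)
have eqFX : F :=: X.
  apply/eqP; rewrite eqEsubset sFX.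
  rewrite Fitting_max ?(pgroup_nil (pHall_pgroup sylX)) //.
  by rewrite sub_der1_normal ?(pHall_sub sylX) // (subset_trans sN'F).
have sylF : r.-Sylow(N) F by rewrite eqFX.
have [C hallC] := Hall_exists r^' solN.
have sCN := pHall_sub hallC.
have co_FC : coprime #|F| #|C|.
  exact: pnat_coprime (pHall_pgroup sylF) (pHall_pgroup hallC).
have tiFC : F :&: C = 1 := coprime_TIg co_FC.
have defN : F * C = N.
  apply/eqP; rewrite eqEcard mul_subG ?(normal_sub nsFN) // andTb.
  by rewrite coprime_cardMg // (card_Hall sylF) (card_Hall hallC) partnC.
exists r^', N, F, C; do !split=> //.
have nFC : C \subset 'N(F) := subset_trans sCN (normal_norm nsFN).
have sRF : [~: F, C] \subset F by rewrite commg_subl.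
(* [Y] is normal in [G] by Frattini. If proper in [N] it would be nilpotent, hence inside [F],
   forcing C = 1 and [N] nilpotent. So Y = N, and Dedekind's law gives [F, C] = F. *)
pose Y := ([~: F, C] <*> C)%G.
have nRC : C \subset 'N([~: F, C]) := commg_normr _ _.
have sYN : Y \subset N by rewrite join_subG sCN (subset_trans sRF) ?normal_sub.
have nYF : F \subset 'N(Y).
  apply/subsetP=> f Ff; rewrite inE conjYg join_subG.
  rewrite (normsP (commg_norml F C) f Ff) joing_subl /=.
  apply/subsetP=> _ /imsetP[c Cc ->]; rewrite conjg_mulR groupM //.
    exact: (subsetP (joing_subr _ _)).
  by apply: (subsetP (joing_subl _ _)); rewrite commGC mem_commg.
have nsYG : Y <| G.
  apply/andP; split; first exact: subset_trans sYN (normal_sub nsNG).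
  have {1}<- := Hall_Frattini_arg solN nsNG hallC.
  apply: mul_subG.
    rewrite -defN; apply: mul_subG => //.
    exact: subset_trans (joing_subr _ _) (normG _).
  have sub : 'N_G(C) \subset 'N([~: F, C]).
    by rewrite normsR ?subsetIr // (subset_trans (subsetIl _ _)) ?normal_norm.
  by rewrite normsY // subsetIr.
have defY : Y :=: N.
  apply: contraNeq nnilN => /(nilP Y nsYG sYN) nilY.
  have sYF : Y \subset F.
    by apply: Fitting_max nilY; apply: normalS sYN (normal_sub nsNG) nsYG.
  have C1 : C :=: 1.
    apply/trivgP; rewrite -tiFC subsetI subxx andbT.
    exact: subset_trans (joing_subr _ _) sYF.
  by rewrite -defN C1 mulg1.
rewrite /= norm_joinEr // in defY.
rewrite -[LHS]mulg1 -tiFC setIC group_modl // defY.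
by apply/setIidPr; rewrite normal_sub.
Qed.

End DerivedSeries.

(** * Induction on the group order *)

(** The factor 2^(k+1) is at most 4c, which the cube of [(uphalf c).+1] covers; equality at c = 2
    dictates the exponent 3. *)
Lemma supplement_count_bound d c k s t :
    0 < c -> (2 ^ k <= maxn 1 c.*2)%N -> (2 ^ d <= 4 * s ^ 3)%N ->
    s * (uphalf c).+1 <= t ->
  (2 ^ (k.+1 + d) <= 4 * t ^ 3)%N.
Proof.
move=> c_gt0; rewrite (maxn_idPr _) ?double_gt0 // => le_k le_d le_t.
have le_c : (4 * c <= (uphalf c).+1 ^ 3)%N.
  have : c <= (uphalf c).*2 by lia.
  by have := uphalf_gt0 c; rewrite c_gt0; move: (uphalf c) => u; nia.
apply: (@leq_trans (4 * (s * (uphalf c).+1) ^ 3)%N).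
  rewrite expnMn mulnA expnD mulnC leq_mul // (leq_trans _ le_c) //.
  by rewrite expnS (leq_trans (leq_mul (leqnn 2) le_k)) // -mul2n mulnA.
by rewrite leq_mul2l leq_exp2r.
Qed.

Theorem derived_series_bound (gT : finGroupType) (G : {group gT}) :
    solvable G -> G :!=: 1 ->
  exists2 d, G^`(d) = 1 & (2 ^ d <= 4 * #|nonSN_classes G 1| ^ 3)%N.
Proof.
have [m] := ubnP #|G|; elim: m => // m IHm in gT G *; rewrite ltnS => le_Gm.
move=> solG ntG.
have quoP (A : {group gT}) : A <| G -> A :!=: 1 -> A :!=: G ->
    exists2 d, G^`(d) \subset A & (2 ^ d <= 4 * #|nonSN_classes G A| ^ 3)%N.
  move=> nsAG ntA neqAG; have [sAG nAG] := andP nsAG.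
  have [|||d dA le_d] := IHm _ (G / A)%G.
  - by apply: leq_trans le_Gm; apply: ltn_quotient.
  - exact: quotient_sol.
  - apply: contraNneq neqAG => /trivgP.
    by rewrite quotient_sub1 // eqEsubset sAG.
  exists d; first exact: quotient_der_eq1 nsAG dA.
  apply: leq_trans le_d _.
  by rewrite leq_mul2l leq_exp2r // quotient_nonSN_classes.
have clS (A : {group gT}) : #|nonSN_classes G A| <= #|nonSN_classes G 1|.
  exact: subset_leq_card (nonSN_classesS G A).
case: (pickP [pred AB : {group gT} * {group gT} |
  [&& AB.1 <| G, AB.2 <| G, AB.1 :!=: 1, AB.2 :!=: 1 & AB.1 :&: AB.2 == 1]]).
  case=> A B /= /and5P[nsAG nsBG ntA ntB /eqP tiAB].
  have neqA : A :!=: G.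
    apply: contraNneq ntB => eqA; rewrite -tiAB eqA; apply/eqP/esym/setIidPr.
    exact: normal_sub.
  have neqB : B :!=: G.
    apply: contraNneq ntA => eqB; rewrite -tiAB eqB; apply/eqP/esym/setIidPl.
    exact: normal_sub.
  have [d1 dA le1] := quoP A nsAG ntA neqA.
  have [d2 dB le2] := quoP B nsBG ntB neqB.
  have le_cl (N : {group gT}) e : (2 ^ e <= 4 * #|nonSN_classes G N| ^ 3)%N ->
      (2 ^ e <= 4 * #|nonSN_classes G 1| ^ 3)%N.
    by move/leq_trans; apply; rewrite leq_mul2l /= leq_exp2r // clS.
  exists (maxn d1 d2).
    apply/trivgP; rewrite -tiAB subsetI.
    rewrite (subset_trans (der_sub_leq _ (leq_maxl _ _)) dA).
    exact: subset_trans (der_sub_leq _ (leq_maxr _ _)) dB.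
  by rewrite /maxn; case: ifP => _; [apply: le_cl le2 | apply: le_cl le1].
move=> noAB.
have [nilG' | nnilG'] := boolP (nilpotent G^`(1)).
  have [k dk le_k] := nilpotent_der_eq1 nilG'.
  (* Here 2^(k+1) is at most 2 max(1, 2c), and c < S(G) makes this at most 4 S(G). *)
  exists (k + 1); first by rewrite derD.
  have := nil_class_der1_classes solG ntG nilG'; move: le_k.
  set c := nil_class _; set s := #|_| => le_k lt_s.
  rewrite addn1 expnS; apply: (@leq_trans (4 * s)%N).
    by move: le_k; rewrite leq_max => /orP[]; lia.
  by rewrite leq_mul2l /= -{1}(expn1 s) leq_pexp2l //; lia.
have mono (A B : {group gT}) : A <| G -> B <| G -> A :&: B = 1 ->
    A :!=: 1 -> B :=: 1.
  move=> nsA nsB tiAB ntA; apply/eqP; have := noAB (A, B).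
  by rewrite /= nsA nsB ntA tiAB eqxx andbT /=; case: eqP.
have [pi [N [F [C [[nsNG sNG' nsFG nilF sN'F] [hallC defN tiFC defF ntF]]]]]] :=
  minimal_nonnilpotent_structure solG (der_normal 1 G) nnilG' mono.
have solN := solvableS (normal_sub nsNG) solG.
have ltNG : N \proper G.
  exact: sub_proper_trans sNG' (sol_der1_proper solG (subxx G) ntG).
have ntN : N :!=: 1.
  apply: contraNneq ntF => N1; apply/eqP/trivgP; rewrite -N1 -defN.
  exact: mulG_subl.
have [d dN le_d] := quoP N nsNG ntN (proper_neq ltNG).
have [k dF le_k] := nilpotent_der_eq1 nilF.
(* [d] steps lead into [N], one more into [F], and [k] more to 1. *)
exists (k.+1 + d).
  rewrite derD -addn1 derD; apply/trivgP; rewrite -dF.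
  exact: dergS (subset_trans (dergS 1 dN) sN'F).
apply: supplement_count_bound le_k le_d _; first by rewrite lt0n nil_class0.
exact: nonSN_classes_supplement hallC defN tiFC nilF defF.
Qed.

(** * Passage to real logarithms *)

(* Importing the reals rebinds the nat_scope notations, hence the prefix forms. *)
Section RealBound.

Import Reals.Reals Lra.

(** Logarithms give d <= 3 log_2(n + 1) + 2, within the stated bound. *)
Lemma dl_bound_ge d n :
  leq (expn 2 d) (muln 4 (expn (addn n 1) 3)) -> Rle (INR d) (dl_bound n).
Proof.
rewrite /dl_bound => le_d.
have ln2 : Rlt 0 (ln (INR 2)) by rewrite -ln_1; apply: ln_increasing => /=; lra.
have INRX a b : INR (expn a b) = pow (INR a) b.
  by elim: b => [|b IHb] //=; rewrite expnS mult_INR IHb.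
have n_gt0 : Rlt 0 (INR (addn n 1)) by apply: lt_0_INR; lia.
have := le_INR _ _ (elimT leP le_d); rewrite mult_INR !INRX => le_R.
have two_gt0 : Rlt 0 (INR 2) by rewrite /=; lra.
have : Rle (ln (pow (INR 2) d))
           (ln (Rmult (pow (INR 2) 2) (pow (INR (addn n 1)) 3))).
  have [lt_R | ->] : Rle (pow (INR 2) d)
      (Rmult (pow (INR 2) 2) (pow (INR (addn n 1)) 3)).
  - by apply: Rle_trans le_R _; rewrite /=; lra.
  - by apply: Rlt_le; apply: ln_increasing lt_R; apply: pow_lt.
  exact: Rle_refl.
rewrite ln_mult ?ln_pow; try by [|apply: pow_lt].
move: ln2; set l := ln (INR (addn n 1)); set l2 := ln (INR 2) => ln2 le_l.
apply: (Rmult_le_reg_r l2) => //.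
have -> : Rmult (Rplus (Rmult (INR 3) (Rdiv l l2)) (INR 9)) l2
  = Rplus (Rmult (INR 3) l) (Rmult (INR 9) l2) by field; lra.
move: le_l; rewrite /=; lra.
Qed.

End RealBound.

Theorem mainTheorem20 (gT : finGroupType) (G : {group gT}) (n : nat) :
  solvable G -> D_count G = n ->
  Reals.Rdefinitions.Rle (Reals.Raxioms.INR (derived_length G)) (dl_bound n).
Proof.
move=> solG defn; apply: dl_bound_ge.
(* For G = 1 the count S(G) is 0 and the inductive bound fails, so this case is separate. *)
case: (eqVneq (G : {set gT}) 1) => [G1 | ntG].
  have : derived_length G <= 0 by apply: derived_length_leq.
  by rewrite leqn0 => /eqP->; rewrite expn0; lia.
have [d /derived_length_leq le_d le_2d] := derived_series_bound solG ntG.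
apply: leq_trans (leq_trans le_2d _); first by rewrite leq_exp2l.
by rewrite leq_mul2l leq_exp2r // addn1 -defn card_nonSN_classes.
Qed.
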